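(* Let $q>1$ and $n\ge 1$ be integers. There exists a $(2q-2)$-layer latin $(n+1)$-cuboid of order $q$ that has no transversal.
   Context: Let $Q_q=\{0,\dots,q-1\}$. A latin $n$-cube of order $q$ is a map $Q_q^n\to Q_q$ such that every line (cells obtained by fixing all coordinates but one) contains all $q$ symbols. For $k\ge 1$, a $k$-layer latin $(n+1)$-cuboid of order $q$ is an array $C$ of size $k\times q\times\cdots\times q$ ($n+1$ dimensions) with entries in $Q_q$ such that for each fixed value $l$ of the first coordinate, the layer $(x_1,\dots,x_n)\mapsto C(l,x_1,\dots,x_n)$ is a latin $n$-cube of order $q$. A hyperplane of $C$ is the set of cells obtained by fixing any one of its $n+1$ coordinates at one value. For $k\ge q$, a transversal of $C$ is a set of $q$ cells such that every hyperplane contains at most one of these cells and the symbols in these cells are pairwise distinct. *)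

(* Defs.v *)
From mathcomp Require Import all_boot.

Set Implicit Arguments.
Unset Strict Implicit.
Unset Printing Implicit Defensive.

Section LatinCuboids.

Variables q n : nat.

Definition point : finType := {ffun 'I_n -> 'I_q}.

Definition line (x : point) (i : 'I_n) : {set point} :=
  [set y : point | [forall j : 'I_n, (j != i) ==> (y j == x j)]].

Definition latin_cube (f : point -> 'I_q) : Prop :=
  forall (x : point) (i : 'I_n) (s : 'I_q), exists2 y, y \in line x i & f y = s.

Variable k : nat.

(* A cell of the k x q x ... x q array: the first of its n + 1 coordinates
   (the layer) is kept apart, as it ranges over 'I_k instead of 'I_q. *)
Definition cell : finType := ('I_k * point)%type.

Definition latin_cuboid (C : cell -> 'I_q) : Prop :=
  forall l : 'I_k, latin_cube (fun x => C (l, x)).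

Definition hyperplane (H : {set cell}) : Prop :=
  (exists l : 'I_k, H = [set c : cell | c.1 == l]) \/
  (exists (i : 'I_n) (a : 'I_q), H = [set c : cell | c.2 i == a]).

(* Meant for q <= k only: for k < q no set of cells satisfies this. *)
Definition is_cuboid_transversal (C : cell -> 'I_q) (T : {set cell}) : Prop :=
  [/\ #|T| = q,
      forall H : {set cell}, hyperplane H -> #|H :&: T| <= 1
    & {in T &, injective C}].

End LatinCuboids.

(* Main.v *)
Require Import Defs.
From mathcomp Require Import all_boot zify.

(** Take layers that are shifts [x_1 + ... + x_n + c_l] of the cyclic latin cube
    mod [q].  Summing the symbols over a transversal, each coordinate and the
    symbols contribute [0 + ... + (q - 1) = 'C(q, 2)], so the shifts [c_l] of the
    [q] layers used must sum to [(1 - n) 'C(q, 2)] mod [q].  If [q] or [n] is odd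
    this is [0]; with [q - 1] layers of shift [1] and [q - 1] of shift [0] the
    shifts of any [q] layers sum to a number in [[1, q - 1]], which is not [0].
    If [q] and [n] are even it is [q / 2], and all shifts equal to [0] will do. *)

Lemma sum_injective_ord (T : finType) (q : nat) (A : {set T}) (f : T -> 'I_q) :
  #|A| = q -> {in A &, injective f} -> \sum_(a in A) (f a : nat) = 'C(q, 2).
Proof.
move=> cardA injf.
have imf : f @: A = setT.
  by apply/eqP; rewrite eqEcard subsetT /= card_in_imset // cardsT card_ord cardA.
rewrite -(big_imset (fun i : 'I_q => i : nat)) // imf -bin2_sum big_mkord.
by apply: eq_bigl => i; rewrite in_setT.
Qed.

Lemma bin2_mul2 (q : nat) : 'C(q, 2) * 2 = q * q.-1.
Proof. by rewrite mulnC -mul_bin_diag bin1. Qed.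

Lemma odd_dvdn_bin2 (q : nat) : odd q -> q %| 'C(q, 2).
Proof.
move=> q_odd; have cop : coprime q 2 by rewrite coprimen2.
by rewrite -(Gauss_dvdl _ cop) bin2_mul2 dvdn_mulr.
Qed.

(** From ['C(q, 2) = m * q] it would follow that [q - 1 = 2 * m], although [q - 1] is odd. *)
Lemma even_Ndvdn_bin2 (q : nat) : 1 < q -> ~~ odd q -> ~~ (q %| 'C(q, 2)).
Proof.
move=> q_gt1 q_even; apply/negP => /dvdnP [m binE].
move/eqP: (bin2_mul2 q); rewrite binE mulnAC mulnC eqn_pmul2l ?(ltnW q_gt1) //.
by move/eqP; lia.
Qed.

Section ShiftedCuboid.

Variables (q n k : nat) (q_gt0 : 0 < q) (shift : nat -> nat).

Definition shifted_cuboid (c : cell q n k) : 'I_q :=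
  Ordinal (ltn_pmod (\sum_i (c.2 i : nat) + shift c.1) q_gt0).

Lemma shifted_cuboid_latin : latin_cuboid shifted_cuboid.
Proof.
move=> l x i s.
pose r := \sum_(j | j != i) (x j : nat) + shift l.
(* [q - r %% q] represents [-r] mod [q], so [a] is the one value of coordinate [i] that yields the
   symbol [s]. *)
pose a := Ordinal (ltn_pmod (s + (q - r %% q)) q_gt0).
exists [ffun j => if j == i then a else x j].
  by rewrite inE; apply/forallP => j; apply/implyP => /negPf ji; rewrite ffunE ji.
apply: val_inj => /=.
rewrite (bigD1 i) //= ffunE eqxx /=.
under eq_bigr => j /negPf ji do rewrite ffunE ji.
rewrite -addnA -/r modnDml -modnDmr -addnA subnK; last exact/ltnW/ltn_pmod.
by rewrite modnDr modn_small.
Qed.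

Lemma transversal_layer_inj (C : cell q n k -> 'I_q) (T : {set cell q n k}) :
  is_cuboid_transversal C T -> {in T &, injective fst}.
Proof.
case=> _ hypT _ c d cT dT cd.
have /card_le1_eqP := hypT _ (or_introl (ex_intro _ c.1 erefl)).
by apply; rewrite !inE ?cd ?eqxx ?cT ?dT.
Qed.

Lemma transversal_coord_inj (C : cell q n k -> 'I_q) (T : {set cell q n k}) i :
  is_cuboid_transversal C T -> {in T &, injective (fun c : cell q n k => c.2 i)}.
Proof.
case=> _ hypT _ c d cT dT cd.
have /card_le1_eqP :=
  hypT _ (or_intror (ex_intro _ i (ex_intro _ (c.2 i) erefl))).
by apply; rewrite !inE ?cd ?eqxx ?cT ?dT.
Qed.

Lemma shifted_cuboid_transversal (T : {set cell q n k}) :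
  is_cuboid_transversal shifted_cuboid T ->
  'C(q, 2) = n * 'C(q, 2) + \sum_(c in T) shift c.1 %[mod q].
Proof.
move=> trT; have [cardT _ injC] := trT.
rewrite -{1}(sum_injective_ord _ _ _ _ cardT injC) modn_summ big_split /=.
(* With the sums swapped, each inner sum runs over [T] for a single coordinate, which is injective
   on [T]. *)
rewrite exchange_big /=.
under eq_bigr => i _ do
  rewrite (sum_injective_ord _ _ _ _ cardT (transversal_coord_inj _ _ i trT)).
by rewrite sum_nat_const card_ord.
Qed.

End ShiftedCuboid.

(** Serves to show that [m] consecutive layers hold at most [m] cells of a transversal. *)
Lemma card_inj_interval (T : finType) (k a m : nat) (A : {set T}) (f : T -> 'I_k) :
  {in A &, injective f} -> (forall x, x \in A -> a <= f x < a + m) -> #|A| <= m.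
Proof.
move=> injf fA.
have g_inj : {in enum A &, injective (fun x => f x : nat)}.
  by move=> x y; rewrite !mem_enum => xA yA /val_inj; apply: injf.
rewrite cardE -(size_map (fun x => f x : nat)) -(size_iota a m).
apply: uniq_leq_size; first by rewrite map_inj_in_uniq ?enum_uniq.
by move=> y /mapP [x]; rewrite mem_enum => xA ->; rewrite mem_iota fA.
Qed.

Theorem theorem3 (q n : nat) (hq : 1 < q) (hn : 1 <= n) :
  exists C : cell q n (2 * q - 2) -> 'I_q,
    latin_cuboid C /\ ~ (exists T : {set cell q n (2 * q - 2)}, is_cuboid_transversal C T).
Proof.
have q_gt0 := ltnW hq.
have [odd_qn | even_qn] := boolP (odd q || odd n).
  exists (shifted_cuboid q n _ q_gt0 (fun l => l < q.-1)).
  split=> [|[T trT]]; first exact: shifted_cuboid_latin.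
  have := shifted_cuboid_transversal _ _ _ _ _ _ trT.
  have [cardT _ _] := trT; have injl := transversal_layer_inj _ _ _ _ _ trT.
  pose A := [set c : cell q n (2 * q - 2) | c.1 < q.-1].
  have -> : \sum_(c in T) ((c.1 < q.-1) : nat) = #|T :&: A|.
    rewrite -sum1_card big_mkcond [RHS]big_mkcond; apply: eq_bigr => c _.
    by rewrite !inE; case: (c \in T); case: (c.1 < q.-1).
  have leA : #|T :&: A| <= q.-1.
    apply: (@card_inj_interval _ _ 0 _ _ fst).
      by apply: sub_in2 injl => c; rewrite inE => /andP [].
    by move=> c; rewrite !inE => /andP [].
  (* The layers of shift 0 are the [q - 1] values from [q - 1] to [2 * q - 3]. *)
  have leD : #|T :\: A| <= q.-1.
    apply: (@card_inj_interval _ _ q.-1 _ _ fst).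
      by apply: sub_in2 injl => c; rewrite inE => /andP [].
    by move=> c; rewrite !inE -leqNgt => /andP [-> _]; have := ltn_ord c.1; lia.
  have := cardsID A T; rewrite cardT => sumA modE.
  (* The two parts of [T] add up to [q] and neither exceeds [q - 1], so [T :&: A] has between 1 and
     [q - 1] cells. *)
  suff : q %| #|T :&: A| by move/dvdn_leq; lia.
  have dvd_nbin : q %| n.-1 * 'C(q, 2).
    case: (boolP (odd q)) odd_qn => [/odd_dvdn_bin2 ? _ | _ /= n_odd].
      exact: dvdn_mull.
    have -> : n.-1 = n./2 * 2 by lia.
    by rewrite -mulnA [2 * _]mulnC bin2_mul2 dvdn_mull // dvdn_mulr.
  (* Adding ['C(q, 2)] to both sides turns the divisibility into the congruence [modE], as
     [n = n.-1 + 1]. *)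
  rewrite -(dvdn_addr _ dvd_nbin) /dvdn -[X in _ == X](mod0n q).
  rewrite -(eqn_modDl 'C(q, 2)) addn0 addnA -mulSn prednK //.
  exact/eqP/esym.
exists (shifted_cuboid q n _ q_gt0 (fun=> 0)).
split=> [|[T trT]]; first exact: shifted_cuboid_latin.
move: even_qn; rewrite negb_or => /andP [q_even n_even].
have := shifted_cuboid_transversal _ _ _ _ _ _ trT; rewrite big1 // addn0.
(* For even [n] the coordinates contribute a multiple of [q], so the congruence would force [q] to
   divide ['C(q, 2)]. *)
have -> : n * 'C(q, 2) = n./2 * q.-1 * q.
  by rewrite -mulnA [q.-1 * q]mulnC -bin2_mul2 [_ * 2]mulnC mulnA; congr (_ * _); lia.
rewrite modnMl => /eqP.
exact/negP/even_Ndvdn_bin2.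
Qed.
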